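(* Let $P_n$ be the path graph with $n\geq 3$ vertices $v_1,\ldots,v_n$ (in path order), and let $\mathcal{H}=(H^1,H^2,\ldots,H^n)$ be a sequence of graphs each of which is a star graph or a complete graph. Then $$\dim_{\mathrm{diam}}(P_n\odot\mathcal{H})=|D(P_n\odot\mathcal{H})|+\sum_{i=2}^{n-1}\dim(H^i).$$
   Context: Distances are shortest-path distances: $d_G(u,v)$ is the length of a shortest $u$–$v$ path in the connected graph $G$. The eccentricity of $v$ is $e_G(v)=\max_{u\in V(G)}d_G(u,v)$ and $\operatorname{diam}(G)=\max_v e_G(v)$. A vertex is diametral if its eccentricity equals $\operatorname{diam}(G)$; the diametral set $D(G)$ is the set of all diametral vertices of $G$. For an ordered set $W=\{w_1,\ldots,w_k\}\subseteq V(G)$, the representation of $v$ is $r(v\mid W)=(d_G(v,w_1),\ldots,d_G(v,w_k))$. $W$ is a resolving set of $G$ if $r(u\mid W)\neq r(v\mid W)$ for all distinct $u,v\in V(G)$. The metric dimension $\dim(G)$ is the minimum cardinality of a resolving set of $G$. A diametral resolving set is a resolving set $W$ with $D(G)\subseteq W$; the diametral metric dimension $\dim_{\mathrm{diam}}(G)$ is the minimum cardinality of a diametral resolving set of $G$. Generalized corona: for a graph $G$ with $V(G)=\{v_1,\ldots,v_n\}$ and a sequence of graphs $\mathcal{H}=(H^1,\ldots,H^n)$, $G\odot\mathcal{H}$ is the graph obtained by taking one copy of $G$ and one (disjoint) copy of each $H^i$, and joining the vertex $v_i$ of $G$ to every vertex of the copy of $H^i$, for each $i=1,\ldots,n$.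 $S_m$ denotes the star graph of order $m$ (one center adjacent to $m-1$ leaves) and $K_q$ the complete graph of order $q$. *)

(* Defs.v *)
From mathcomp Require Import all_boot.

Set Implicit Arguments.
Unset Strict Implicit.
Unset Printing Implicit Defensive.

Record sgraph := SGraph {
  vertex :> finType;
  edge : rel vertex;
  edge_sym : symmetric edge;
  edge_irrefl : irreflexive edge
}.
Arguments edge {s}.

Section Metric.
Variable G : sgraph.
Implicit Types (u v w : G) (W : {set G}).

Definition has_path_of_length u v (k : nat) : bool :=
  [exists p : k.-tuple G, [&& path edge u p, last u p == v & uniq (u :: p)]].

(* The least length of a u-v path.  Paths have distinct vertices, hence length *)
(* at most #|G|.-1; the value #|G| is taken only when no u-v path exists.      *)
Definition gdist u v : nat := find (has_path_of_length u v) (iota 0 #|G|).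

Definition ecc v : nat := \max_(u : G) gdist u v.
Definition diam : nat := \max_(v : G) ecc v.
Definition diametral_set : {set G} := [set v | ecc v == diam].

(* The order put on W is the one of enum; being resolving does not depend on it. *)
Definition representation v W : seq nat := [seq gdist v w | w <- enum W].

Definition resolving W : bool :=
  [forall u, forall v, (u != v) ==> (representation u W != representation v W)].

Definition diametral_resolving W : bool :=
  resolving W && (diametral_set \subset W).

(* setT is a valid starting point of both minimisations: see resolving_setT and *)
(* diametral_resolving_setT. In particular the metric dimension of K_1 is 0.    *)
Definition metric_dim : nat := #|[arg min_(W < setT | resolving W) #|W|]|.
Definition diametral_metric_dim : nat :=
  #|[arg min_(W < setT | diametral_resolving W) #|W|]|.

Lemma gdist_eq0 u v : (gdist u v == 0) = (u == v).
Proof.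
rewrite /gdist; case En: #|G| => [|n]; first by have := card0_eq En u.
have P0 : has_path_of_length u v 0 = (u == v).
  apply/existsP/idP => [[p]|uv]; first by rewrite (tuple0 p) /= andbT.
  by exists [tuple]; rewrite /= uv.
by rewrite /= P0; case: (u == v).
Qed.

Lemma resolving_setT : resolving [set: G].
Proof.
apply/forallP => u; apply/forallP => v; apply/implyP; apply: contra => /eqP.
move/eq_in_map/(_ v); rewrite mem_enum inE => /(_ isT) /eqP.
by rewrite -gdist_eq0 => /eqP ->; rewrite gdist_eq0.
Qed.

Lemma diametral_resolving_setT : diametral_resolving [set: G].
Proof. by rewrite /diametral_resolving resolving_setT subsetT. Qed.

End Metric.

Definition is_complete (G : sgraph) : Prop :=
  0 < #|G| /\ forall x y : G, edge x y = (x != y).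

Definition is_star (G : sgraph) : Prop :=
  exists c : G, forall x y : G, edge x y = (x != y) && ((x == c) || (y == c)).

Section PathGraph.
Variable n : nat.

Definition path_edge (i j : 'I_n) : bool := (i.+1 == j) || (j.+1 == i).

Lemma path_edge_sym : symmetric path_edge.
Proof. by move=> i j; rewrite /path_edge orbC. Qed.

Lemma path_edge_irrefl : irreflexive path_edge.
Proof. by move=> i; rewrite /path_edge eqn_leq ltnn. Qed.

Definition path_graph : sgraph := SGraph path_edge_sym path_edge_irrefl.
End PathGraph.

Section Corona.
Variables (G : sgraph) (H : G -> sgraph).

(* inl v is the vertex v of G; inr (existT v x) is x in the copy of H v. *)
Definition corona_vertex : finType := (G + {v : G & H v})%type.

Definition corona_edge (a b : corona_vertex) : bool :=
  match a, b with
  | inl u, inl v => edge u v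
  | inl u, inr y => u == tag y
  | inr x, inl v => tag x == v
  | inr x, inr y => (tag x == tag y) && edge (tagged x) (tagged_as x y)
  end.

Lemma corona_edge_sym : symmetric corona_edge.
Proof.
case=> [u|[u x]] [v|[v y]] //=; first exact: edge_sym.
case: (eqVneq u v) => [uv|] //=.
by move: x y; case: _ / uv => x y; rewrite !tagged_asE edge_sym.
Qed.

Lemma corona_edge_irrefl : irreflexive corona_edge.
Proof. by case=> [u|[u x]] /=; rewrite ?eqxx ?tagged_asE edge_irrefl. Qed.

Definition corona : sgraph := SGraph corona_edge_sym corona_edge_irrefl.
End Corona.

(* Main.v *)
Require Import Defs.
From mathcomp Require Import all_boot.
From mathcomp Require Import zify.

(** Every copy [H i] has diameter at most 2, so the copy is isometrically
embedded in the corona, and only its own vertices tell two of its vertices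
apart. Hence a resolving set meets each [H i] in a resolving set of [H i]. The
diameter is [n.+1], and it is attained exactly at the vertices of the two end
copies. Conversely, the two end copies together with resolving sets of the inner
copies resolve everything: the sum of the distances from a vertex outside the
end copies to the two ends separates path vertices from copy vertices, and then
the distance to the first copy gives the position along the path. *)

Set Implicit Arguments.
Unset Strict Implicit.
Unset Printing Implicit Defensive.

(** * Graph distance characterised by local conditions *)

Section Distance.
Variable G : sgraph.
Implicit Types (u v w : G) (W : {set G}).

(** These local conditions determine the shortest-path metric and force connectedness, so a distance
    formula can be checked edge by edge, without handling paths. *)
Definition is_distance (d : G -> G -> nat) : Prop :=
  [/\ forall u v, (d u v == 0) = (u == v),
      forall u v w, edge v w -> d u w <= (d u v).+1
    & forall u v k, d u v = k.+1 -> exists2 w, edge w v & d u w = k].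

Lemma distance_le_size d u p :
  is_distance d -> path edge u p -> d u (last u p) <= size p.
Proof.
case=> d0 dS _; elim/last_ind: p => [|p x IHp] /=.
  by rewrite leqn0 d0.
rewrite rcons_path last_rcons size_rcons => /andP[/IHp le_p /(dS u)].
by move/leq_trans; apply.
Qed.

(** The third condition leads back from [v] to [u]. The bound on [d u x] is carried through the
    induction for the sake of [uniq]: the appended vertex is farther from [u] than all earlier
    ones. *)
Lemma distance_path d u v :
  is_distance d -> exists p, [/\ path edge u p, last u p = v, size p = d u v
                               & {in u :: p, forall x, d u x <= d u v}
                               /\ uniq (u :: p)].
Proof.
case=> d0 _ dP; move Ek: (d u v) => k; elim: k v Ek => [|k IHk] v Ek.
  exists [::]; split=> //; first by apply/eqP; rewrite -d0 Ek.
  by split=> // x; rewrite inE => /eqP->; rewrite leqn0 d0.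
have [w wv /IHk[p [p_path p_last p_size [p_le p_uniq]]]] := dP _ _ _ Ek.
exists (rcons p v); split; rewrite ?last_rcons ?size_rcons ?p_size //.
  by rewrite rcons_path p_path p_last.
split=> [x|]; rewrite -rcons_cons.
  by rewrite mem_rcons inE => /predU1P[->|/p_le/leqW//]; rewrite Ek.
rewrite rcons_uniq p_uniq andbT; apply/negP => /p_le.
by rewrite Ek ltnn.
Qed.

Lemma gdist_distance d : is_distance d -> forall u v, gdist u v = d u v.
Proof.
move=> dd u v; have [p [p_path p_last p_size [_ p_uniq]]] := distance_path u v dd.
(* A path with distinct vertices has length below [#|G|], so [find] stops inside the range and does
   not return its default. *)
have lt_d : d u v < #|G|.
  by rewrite -p_size -[_ < _]/(size (u :: p) <= _) -(card_uniqP p_uniq) max_card.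
have Pd : has_path_of_length u v (d u v).
  apply/existsP; exists (tcast p_size (in_tuple p)).
  by rewrite val_tcast p_path p_last eqxx.
have hasP : has (has_path_of_length u v) (iota 0 #|G|).
  by apply/hasP; exists (d u v); rewrite ?mem_iota.
apply/eqP; rewrite eqn_leq; apply/andP; split.
  rewrite leqNgt; apply/negP => /(before_find 0).
  by rewrite nth_iota // Pd.
have lt_find : find (has_path_of_length u v) (iota 0 #|G|) < #|G|.
  by move: hasP; rewrite has_find size_iota.
have := nth_find 0 hasP; rewrite nth_iota // add0n -/(gdist u v).
case/existsP=> q /and3P[q_path /eqP q_last _].
by have := distance_le_size dd q_path; rewrite q_last size_tuple.
Qed.

Lemma resolvingP W :
  reflect (forall u v, {in W, forall w, gdist u w = gdist v w} -> u = v)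
          (resolving W).
Proof.
apply: (iffP forallP) => [W_res u v eq_uv|W_res u].
  apply/eqP; have /forallP/(_ v) := W_res u; rewrite implyNb => /orP[//|/negP[]].
  by apply/eqP/eq_in_map => w; rewrite mem_enum => /eq_uv.
apply/forallP => v; apply/implyP; apply: contra => /eqP/eq_in_map eq_uv.
by apply/eqP/W_res => w Ww; apply: eq_uv; rewrite mem_enum.
Qed.

Lemma metric_dim_min :
  exists W, [/\ resolving W, #|W| = metric_dim G
              & forall W', resolving W' -> metric_dim G <= #|W'|].
Proof.
rewrite /metric_dim; case: arg_minnP => [|W W_res W_min].
  exact: resolving_setT.
by exists W.
Qed.

Lemma diametral_metric_dim_min :
  exists W, [/\ diametral_resolving W, #|W| = diametral_metric_dim G
              & forall W', diametral_resolving W' ->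
                  diametral_metric_dim G <= #|W'|].
Proof.
rewrite /diametral_metric_dim; case: arg_minnP => [|W W_res W_min].
  exact: diametral_resolving_setT.
by exists W.
Qed.

(** The metric of a graph in which distinct nonadjacent vertices have a common neighbour. It also
    measures distances inside a copy in any corona, where the base vertex is such a neighbour. *)
Definition dist2 u v : nat := (u != v) + ((u != v) && ~~ edge u v).

Lemma dist2_eq0 u v : (dist2 u v == 0) = (u == v).
Proof. by rewrite /dist2; case: (eqVneq u v). Qed.

Lemma dist2_le2 u v : dist2 u v <= 2.
Proof. by rewrite /dist2; case: (u != v); case: edge. Qed.

Lemma dist2_edge u v w : edge v w -> dist2 u w <= (dist2 u v).+1.
Proof.
move=> vw; have [->|uv] := eqVneq u v.
  by rewrite /dist2 vw andbF addn0; case: (_ != _); case: (_ != _).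
by apply: leq_trans (dist2_le2 _ _) _; rewrite ltnS lt0n dist2_eq0.
Qed.

Lemma dist2_distance :
  (forall u v, u != v -> ~~ edge u v -> exists2 w, edge u w & edge w v) ->
  is_distance dist2.
Proof.
move=> two; split=> [||u v k]; [exact: dist2_eq0|exact: dist2_edge|].
have neq x y : edge x y -> x != y.
  by apply: contraTneq => ->; rewrite edge_irrefl.
rewrite /dist2; case: (eqVneq u v) => //= uv; have [uv1 [<-]|uv0 [<-]] := boolP (edge u v).
  by exists u; rewrite ?eqxx.
have [w uw wv] := two _ _ uv uv0.
by exists w; rewrite ?uw ?neq.
Qed.

Lemma star_or_complete_dist :
  is_star G \/ is_complete G -> forall u v, gdist u v = dist2 u v.
Proof.
move=> GE; apply/gdist_distance/dist2_distance => u v uv; case: GE; last first.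
  by case=> _ ->; rewrite uv.
case=> c cE; rewrite !cE uv /= negb_or => /andP[uc vc].
by exists c; rewrite cE ?uc ?eqxx ?orbT //= eq_sym vc.
Qed.

End Distance.

(** * Distances in a path and in a generalized corona *)

Lemma ltn_ord_path n (i : path_graph n) : i < n. Proof. exact: ltn_ord. Qed.

Definition path_dist n (i j : path_graph n) : nat := (i - j) + (j - i).

Lemma path_distance n : is_distance (@path_dist n).
Proof.
split=> [i j|i j k|i j k]; rewrite /path_dist.
- by rewrite -val_eqE /=; lia.
- by rewrite /= /path_edge; lia.
have lt_i := ltn_ord_path i; have lt_j := ltn_ord_path j.
have [le_ij|lt_ji] := leqP i j => Ek.
  have lt_w : j.-1 < n by lia.
  by exists (Ordinal lt_w); rewrite /= /path_edge /=; lia.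
have lt_w : j.+1 < n by lia.
by exists (Ordinal lt_w); rewrite /= /path_edge /=; lia.
Qed.

Section CoronaDistance.
Variables (G : sgraph) (H : G -> sgraph) (d : G -> G -> nat).

Definition corona_dist (a b : corona H) : nat :=
  match a, b with
  | inl u, inl v => d u v
  | inl u, inr y => (d u (tag y)).+1
  | inr x, inl v => (d (tag x) v).+1
  | inr x, inr y =>
      if tag x == tag y then dist2 (tagged x) (tagged_as x y)
      else (d (tag x) (tag y)).+2
  end.

Lemma eq_inr_corona u (x y : H u) :
  (inr (existT _ u x) == inr (existT _ u y) :> corona H) = (x == y).
Proof. exact: (@eq_Tagged _ H (Tagged H x)). Qed.

Lemma corona_distance : is_distance d -> is_distance corona_dist.
Proof.
case=> d0 dS dP; have dxx u : d u u = 0 by apply/eqP; rewrite d0.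
split.
- case=> [u|[u x]] [v|[v y]] //=.
  case: (eqVneq u v) => [uv|nuv] /=; last first.
    by apply/esym/eqP => -[uv _]; rewrite uv eqxx in nuv.
  move: x y; case: _ / uv => x y; rewrite tagged_asE dist2_eq0.
  by rewrite eq_inr_corona.
- case=> [u|[u x]] [v|[v y]] [w|[w z]] //=.
  + exact: dS.
  + by move/eqP->.
  + by move/eqP->; rewrite ltnW.
  + by case/andP=> /eqP vw _; rewrite -[in leqLHS]vw.
  + by move/dS; apply.
  + move/eqP->; case: eqVneq => [_|//] /=.
    by apply: leq_trans (dist2_le2 _ _) _.
  + move/eqP=> <-; case: eqVneq => [uv|_] /=; last by rewrite ltnW.
    by rewrite [in leqLHS]uv dxx.
  + case: (eqVneq v w) => [vw|//] /=; move: y z; case: _ / vw => y z.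
    rewrite tagged_asE; case: (eqVneq u v) => [uv|//] /=.
    move: x; rewrite uv => x; rewrite !tagged_asE; exact: dist2_edge.
- case=> [u|[u x]] [v|[v y]] k /=.
  + by case/dP=> w wv <-; exists (inl w).
  + by case=> <-; exists (inl v) => /=.
  (* The last step into [inl v] comes from [x] itself if [v] is its base vertex, and otherwise from
     a neighbour of [v] in [G] nearer to [u]. *)
  + case=> duv; have [uv|nuv] := eqVneq u v.
      have k0 : k = 0 by rewrite -duv uv dxx.
      exists (inr (existT _ u x)); rewrite /= ?uv // eqxx tagged_asE.
      by rewrite /dist2 eqxx k0.
    have: d u v != 0 by rewrite d0.
    case: k duv => [->//|k] /dP[w wv <-] _.
    by exists (inl w).
  + case: eqVneq => [uv|nuv] /=; last by case=> <-; exists (inl v) => /=.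
    move: x y; case: _ / uv => x y; rewrite tagged_asE /dist2.
    case: eqVneq => //= nxy; have [xy [<-]|nxy' [<-]] := boolP (edge x y).
      by exists (inr (existT _ u x)); rewrite /= ?eqxx tagged_asE //= /dist2 eqxx.
    by exists (inl u); rewrite /= ?dxx.
Qed.

End CoronaDistance.

(** * Sets of corona vertices, copy by copy *)

Section CoronaFamily.
Variables (G : sgraph) (H : G -> sgraph).

Definition family_set (A : forall i, {set H i}) : {set corona H} :=
  [set a | if a is inr x then tagged x \in A (tag x) else false].

Lemma card_family_set (A : forall i, {set H i}) :
  #|family_set A| = \sum_i #|A i|.
Proof.
under eq_bigr => i _ do rewrite -sum1_card.
rewrite (sig_big_dep _ _ (fun i x => 1)) /=.
rewrite -sum1_card.
rewrite big_mkcond big_sumType /= big1 ?add0n => [|u _]; last by rewrite inE.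
by rewrite [RHS]big_mkcond; apply: eq_bigr => x _; rewrite inE.
Qed.

Definition fibre (W : {set corona H}) (i : G) : {set H i} :=
  [set x | inr (existT _ i x) \in W].

(** Only an inequality, since base vertices in [W] lie in no fibre. *)
Lemma card_fibres (W : {set corona H}) : \sum_i #|fibre W i| <= #|W|.
Proof.
rewrite -card_family_set subset_leq_card //.
by apply/subsetP => -[u|[i x]]; rewrite !inE.
Qed.

End CoronaFamily.

(** * Coronas over a path: eccentricities and diametral vertices *)

Section PathCorona.
Variables (n : nat) (H : path_graph n -> sgraph).
Hypothesis n_ge3 : 3 <= n.
Hypothesis HE : forall i, is_star (H i) \/ is_complete (H i).

Lemma corona_path_gdist (a b : corona H) :
  gdist a b = corona_dist (@path_dist n) a b.
Proof. exact/gdist_distance/corona_distance/path_distance. Qed.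

Lemma gdist_fibre i (x y : H i) :
  gdist (inr (existT _ i x) : corona H) (inr (existT _ i y)) = gdist x y.
Proof.
by rewrite corona_path_gdist /= eqxx tagged_asE star_or_complete_dist.
Qed.

Lemma star_or_complete_gt0 i : 0 < #|H i|.
Proof.
by case: (HE i) => [[c _]|[]//]; rewrite (cardD1 c) inE.
Qed.

Definition inner (i : path_graph n) : bool := 0 < i < n.-1.

Let n_gt0 : 0 < n. Proof. by lia. Qed.
Let n1_lt : n.-1 < n. Proof. by lia. Qed.
Let v_first : path_graph n := Ordinal n_gt0.
Let v_last : path_graph n := Ordinal n1_lt.

Lemma gdist_corona_le (a b : corona H) : gdist a b <= n.+1.
Proof.
rewrite corona_path_gdist; case: a b => [i|[i x]] [j|[j y]] /=.
- by have := ltn_ord_path i; have := ltn_ord_path j; rewrite /path_dist; lia.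
- by have := ltn_ord_path i; have := ltn_ord_path j; rewrite /path_dist; lia.
- by have := ltn_ord_path i; have := ltn_ord_path j; rewrite /path_dist; lia.
have := ltn_ord_path i; have := ltn_ord_path j; rewrite /path_dist.
case: eqVneq => _ lt_j lt_i; last by lia.
by apply: leq_trans (dist2_le2 _ _) _; lia.
Qed.

(** The value [n.+1] takes all [n.-1] edges of the path and one step at each end between a copy and
    its base vertex. Inside one copy distances are at most 2, which is below [n.+1] as [3 <= n]. *)
Lemma gdist_corona_eq (a b : corona H) :
  gdist a b = n.+1 ->
  if b is inr y then ~~ inner (tag y) else false.
Proof.
rewrite corona_path_gdist; case: a b => [i|[i x]] [j|[j y]] /=;
  have := ltn_ord_path i; have := ltn_ord_path j; rewrite /path_dist /inner.
- by lia.
- by lia.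
- by lia.
case: eqVneq => _ lt_j lt_i E; last by lia.
by have := leq_trans n_ge3 (leqnSn n); rewrite -E ltnNge dist2_le2.
Qed.

Lemma gdist_corona_ends j (y : H j) :
  ~~ inner j -> exists a : corona H, gdist a (inr (existT _ j y)) = n.+1.
Proof.
move=> j_end.
have /card_gt0P[x _] := star_or_complete_gt0 v_first.
have /card_gt0P[z _] := star_or_complete_gt0 v_last.
(* The far vertex is taken in the copy at the opposite end of the path. *)
have [j0|j_gt0] := posnP j.
  exists (inr (existT _ v_last z)); rewrite corona_path_gdist /=.
  by rewrite -val_eqE /= j0 /path_dist /= ifN; lia.
exists (inr (existT _ v_first x)); rewrite corona_path_gdist /=.
rewrite -val_eqE /= ifN; last by lia.
by move: j_end; have := ltn_ord_path j; rewrite /path_dist /inner /=; lia.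
Qed.

Lemma ecc_corona_le (a : corona H) : ecc a <= n.+1.
Proof. by apply/bigmax_leqP => b _; apply: gdist_corona_le. Qed.

Lemma ecc_corona_eq (b : corona H) :
  (ecc b == n.+1) = if b is inr y then ~~ inner (tag y) else false.
Proof.
apply/eqP/idP => [Eb|].
  have [|a Ea] := @eq_bigmax _ (fun a => gdist a b); first by rewrite (cardD1 b).
  by apply: (@gdist_corona_eq a b); rewrite -Ea.
case: b => // -[j y] /= /(gdist_corona_ends y)[a Ea].
apply/eqP; rewrite eqn_leq ecc_corona_le -Ea.
exact: (@leq_bigmax _ (fun a : corona H => gdist a _)).
Qed.

Lemma diam_corona : diam (corona H) = n.+1.
Proof.
apply/eqP; rewrite eqn_leq; apply/andP; split.
  by apply/bigmax_leqP => b _; apply: ecc_corona_le.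
have /card_gt0P[x _] := star_or_complete_gt0 v_first.
have <- : ecc (inr (existT _ v_first x) : corona H) = n.+1.
  by apply/eqP; rewrite ecc_corona_eq.
exact: (@leq_bigmax (corona H) (@ecc (corona H))).
Qed.

Lemma diametral_set_corona :
  diametral_set (corona H) =
  family_set (fun i => if inner i then set0 else [set: H i]).
Proof.
apply/setP => a; rewrite !inE diam_corona ecc_corona_eq.
by case: a => // -[i x] /=; case: inner; rewrite !inE.
Qed.

(** * Resolving sets of the corona *)

Lemma resolving_fibre (W : {set corona H}) i :
  resolving W -> resolving (fibre W i).
Proof.
move=> /resolvingP W_res; apply/resolvingP => x y eq_xy.
apply/eqP; rewrite -eq_inr_corona; apply/eqP.
(* The distance from [x] or [y] to a vertex outside copy [i] depends only on [i], so such a vertex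
   cannot separate them. *)
apply: W_res => -[j|[j z]] Wz; first by rewrite !corona_path_gdist.
have [ij|nij] := eqVneq i j.
  move: z Wz; case: _ / ij => z Wz; rewrite !gdist_fibre eq_xy //.
  by rewrite inE.
by rewrite !corona_path_gdist /= !(negbTE nij).
Qed.

Lemma resolving_family_set (A : forall i, {set H i}) :
  (forall i, resolving (A i)) -> (forall i, ~~ inner i -> A i = setT) ->
  resolving (family_set A).
Proof.
move=> A_res A_ends; apply/resolvingP => a b eq_ab.
have copy_in i (x : H i) :
    ~~ inner i -> (inr (existT _ i x) : corona H) \in family_set A.
  by move/A_ends=> Ai; rewrite inE /= Ai inE.
(* A member of the set is recognised by its distance 0 to itself, which leaves the case of [a] and
   [b] both outside the set. *)
have in_set w : w \in family_set A -> (a == w) = (b == w).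
  by move=> /eq_ab; rewrite -!gdist_eq0 => ->.
have [aA|aA] := boolP (a \in family_set A).
  by apply/esym/eqP; rewrite -in_set.
have [bA|bA] := boolP (b \in family_set A).
  by apply/eqP; rewrite in_set.
have /card_gt0P[x0 _] := star_or_complete_gt0 v_first.
have /card_gt0P[z0 _] := star_or_complete_gt0 v_last.
have first_end : ~~ inner v_first by [].
have last_end : ~~ inner v_last by rewrite /inner /= ltnn andbF.
have := eq_ab _ (copy_in _ x0 first_end); have := eq_ab _ (copy_in _ z0 last_end).
rewrite !corona_path_gdist.
have copy_inner i (x : H i) :
    (inr (existT _ i x) : corona H) \notin family_set A -> inner i.
  by apply: contraR; apply: copy_in.
case: a b eq_ab in_set aA bA => [i|[i x]] [j|[j y]] eq_ab _ aA bA /=.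
- rewrite /path_dist /= => Ez Ex; congr inl; apply: val_inj => /=.
  by have := ltn_ord_path i; have := ltn_ord_path j; lia.
(* The distances to the two end copies add up to [n.+1] for a path vertex and to [n.+3] for a vertex
   of an inner copy. *)
- have := copy_inner _ _ bA; rewrite -!val_eqE /path_dist /inner /= => j_inner.
  by have := ltn_ord_path i; have := ltn_ord_path j; rewrite !ifN; lia.
- have := copy_inner _ _ aA; rewrite -!val_eqE /path_dist /inner /= => i_inner.
  by have := ltn_ord_path i; have := ltn_ord_path j; rewrite !ifN; lia.
have := copy_inner _ _ aA; have := copy_inner _ _ bA.
rewrite -!val_eqE /path_dist /inner /= => j_inner i_inner.
rewrite !ifN; try by lia.
(* The distance to the first copy is the index plus 2. Once the copies agree, [A i] separates their
   vertices. *)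
move=> Ez Ex; have ij : i = j.
  by apply: val_inj => /=; have := ltn_ord_path i; have := ltn_ord_path j; lia.
move: y eq_ab {Ez Ex j_inner aA bA}; case: _ / ij => y eq_ab.
congr (inr (existT _ _ _)); apply: (resolvingP _ (A_res i)) => w Aw.
by rewrite -!gdist_fibre; apply: eq_ab; rewrite inE.
Qed.

End PathCorona.

(** * The formula: both inequalities, copy by copy *)

Theorem theorem3p1 (n : nat) (hn : 3 <= n) (H : path_graph n -> sgraph)
  (hH : forall i : path_graph n, is_star (H i) \/ is_complete (H i)) :
  diametral_metric_dim (corona H) =
  #|diametral_set (corona H)|
  + \sum_(i < n | 0 < i < n.-1) metric_dim (H i).
Proof.
have inner_ends i : ~~ inner i -> fibre (diametral_set (corona H)) i = setT.
  move=> /negbTE i_end; apply/setP => x.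
  by rewrite diametral_set_corona // !inE /= i_end inE.
rewrite {1}diametral_set_corona // card_family_set.
(* Padding the second sum with zeros merges both into one sum over all copies, so the two bounds can
   be compared term by term. *)
rewrite [X in _ + X]big_mkcond -big_split /=.
apply/eqP; rewrite eqn_leq; apply/andP; split.
  have [B B_min] := fin_all_exists (fun i => metric_dim_min (H i)).
  (* Minimum resolving sets inside, whole copies at the ends: this attains the claimed value. *)
  pose A i := if inner i then B i else [set: H i].
  have A_ends i : ~~ inner i -> A i = setT by rewrite /A => /negbTE->.
  have [W [_ _ W_min]] := diametral_metric_dim_min (corona H).
  apply: leq_trans (W_min (family_set A) _) _.
    apply/andP; split.
      apply: resolving_family_set => // i; rewrite /A; case: ifP => _.
        by case: (B_min i).
      exact: resolving_setT.
    rewrite diametral_set_corona //; apply/subsetP => a.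
    rewrite !inE; case: a => // -[i x] /=; rewrite /A.
    by case: (inner i); rewrite !inE.
  rewrite card_family_set leq_sum // => i _; rewrite /A /inner.
  by case: ifP => _; rewrite ?cards0 ?addn0 //; case: (B_min i) => _ ->.
have [W [/andP[W_res W_diam] <- _]] := diametral_metric_dim_min (corona H).
(* Each inner fibre of [W] resolves its copy, and each end fibre is the full copy because [W]
   contains the diametral set. *)
apply: leq_trans (card_fibres W); apply: leq_sum => i _.
rewrite -/(inner i); case: ifPn => [_|/inner_ends i_end].
  have [B [_ _ B_min]] := metric_dim_min (H i).
  by rewrite cards0; apply: B_min; apply: resolving_fibre.
rewrite addn0 -i_end subset_leq_card //; apply/subsetP => x.
by rewrite ![x \in _]inE; apply: (subsetP W_diam).
Qed.
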